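(* For every $n\ge 3$, the random variable $\mathsf{H}(\mathcal{A}_n)$ does not stochastically dominate $\mathsf{H}(\mathcal{R}_n)$, i.e. $\mathsf{H}(\mathcal{A}_n)\not\succeq_{\mathrm{st}}\mathsf{H}(\mathcal{R}_n)$, where $\mathcal{R}_n=\mathcal{T}((+1)^n)$ and $\mathcal{A}_n=\mathcal{T}((+1,-1)^n)$.
   Context: Uniform attachment with freezing. For a choice sequence $\mathbf{x}=(\mathrm{x}_i)_{1\le i\le m}\in\{-1,+1\}^m$ let $S_0(\mathbf{x})=1$ and $S_j(\mathbf{x})=1+\sum_{i=1}^j \mathrm{x}_i$ for $1\le j\le m$. Assume $S_j(\mathbf{x})>0$ for every $1\le j\le m-1$. Random rooted trees $\mathcal{T}_0(\mathbf{x}),\dots,\mathcal{T}_m(\mathbf{x})$, whose vertices are each labelled either active or frozen, are built recursively: $\mathcal{T}_0(\mathbf{x})$ is a single active root vertex; for $1\le j\le m$, let $V_j$ be a uniformly random active vertex of $\mathcal{T}_{j-1}(\mathbf{x})$, chosen independently of all previous choices; if $\mathrm{x}_j=-1$ (freezing step), $\mathcal{T}_j(\mathbf{x})$ is obtained from $\mathcal{T}_{j-1}(\mathbf{x})$ by changing the label of $V_j$ from active to frozen; if $\mathrm{x}_j=+1$ (attachment step), $\mathcal{T}_j(\mathbf{x})$ is obtained from $\mathcal{T}_{j-1}(\mathbf{x})$ by adding a new active vertex joined by an edge to $V_j$. Set $\mathcal{T}(\mathbf{x})=\mathcal{T}_m(\mathbf{x})$. The height $\mathsf{H}(T)$ of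 a rooted tree $T$ is the maximal graph distance of a vertex of $T$ to the root. Notation: $(+1)^n$ is the sequence of $n$ entries all equal to $+1$, so $\mathcal{R}_n$ is the random recursive tree with $n$ edges; $(+1,-1)^n$ is the alternating sequence $(+1,-1,+1,-1,\dots,+1,-1)$ of length $2n$. For real random variables $X,Y$, $X\succeq_{\mathrm{st}}Y$ means $\mathbb{P}(X\ge t)\ge\mathbb{P}(Y\ge t)$ for every $t\in\mathbb{R}$. *)

(* Defs.v *)
From HB Require Import structures.
From mathcomp Require Import all_boot all_order all_algebra.
From mathcomp Require Import all_classical all_reals all_analysis.

Set Implicit Arguments.
Unset Strict Implicit.
Unset Printing Implicit Defensive.

Import Order.TTheory GRing.Theory Num.Theory.
Local Open Scope classical_set_scope.
Local Open Scope ring_scope.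

(** * Rooted trees with active and frozen vertices *)

(* The vertices are the natural numbers below [order], numbered in order of
   appearance; the root is 0. An edge is listed once, in either direction. *)
Record ltree := LTree {
  order : nat;
  edges : seq (nat * nat);
  frozen : seq nat }.

Definition active (t : ltree) : seq nat :=
  [seq v <- iota 0 (order t) | v \notin frozen t].

Definition adj (t : ltree) : rel nat :=
  fun u v => ((u, v) \in edges t) || ((v, u) \in edges t).

Definition walk_of_length (t : ltree) (u v k : nat) : bool :=
  [exists p : k.-tuple 'I_(order t),
     path (adj t) u (map val p) && (last u (map val p) == v)].

(* Least length of a walk from [u] to [v]. Lengths below [order t] are enough,
   and [find] returns [order t] when there is no such walk, which does not
   happen in a tree. *)
Definition graph_dist (t : ltree) (u v : nat) : nat :=
  find (walk_of_length t u v) (iota 0 (order t)).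

Definition height (t : ltree) : nat := \max_(v < order t) graph_dist t 0 v.

(** * Uniform attachment with freezing *)

Definition root_tree : ltree := LTree 1 [::] [::].

Definition attach (v : nat) (t : ltree) : ltree :=
  LTree (order t).+1 ((v, order t) :: edges t) (frozen t).

Definition freeze (v : nat) (t : ltree) : ltree :=
  LTree (order t) (edges t) (v :: frozen t).

Definition uaf_step (s : int) (v : nat) (t : ltree) : ltree :=
  if s == 1 then attach v t else freeze v t.

(* Indices are shifted by one: the (j+1)-st step has sign [x`_j] and acts on
   the vertex [v j]. *)
Fixpoint uaf_tree (x : seq int) (v : nat -> nat) (j : nat) : ltree :=
  if j is i.+1 then uaf_step x`_i (v i) (uaf_tree x v i) else root_tree.

Definition active_count (x : seq int) (j : nat) : int :=
  1 + \sum_(s <- take j x) s.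

Definition choice_sequence (x : seq int) : Prop :=
  (forall s, s \in x -> s = 1 \/ s = -1) /\
  (forall j, (1 <= j <= (size x).-1)%N -> 0 < active_count x j).

(* Given any values [v 0, ..., v (j-1)] of the previously chosen vertices, the
   next chosen vertex is uniform among the active vertices of the current
   tree. Only the first [size x] variables [V j] matter. *)
Definition uaf_choices (R : realType) (d : measure_display)
    (Omega : measurableType d) (P : probability Omega R)
    (x : seq int) (V : nat -> {RV P >-> nat}) : Prop :=
  choice_sequence x /\
  forall (j : nat) (v : nat -> nat), (j < size x)%N ->
    let a := active (uaf_tree x v j) in
    P [set w | forall i, (i <= j)%N -> V i w = v i] =
    (P [set w | forall i, (i < j)%N -> V i w = v i] *
     (if v j \in a then (size a)%:R^-1 else 0)%R%:E)%E.

Arguments uaf_choices {R d Omega} P x V.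

Definition uaf_height (R : realType) (d : measure_display)
    (Omega : measurableType d) (P : probability Omega R)
    (x : seq int) (V : nat -> {RV P >-> nat}) : Omega -> R :=
  fun w => (height (uaf_tree x (V ^~ w) (size x)))%:R.

Lemma measurable_uaf_height (R : realType) (d : measure_display)
    (Omega : measurableType d) (P : probability Omega R)
    (x : seq int) (V : nat -> {RV P >-> nat}) :
  measurable_fun setT (uaf_height x V).
Proof.
suff mT j (A : set ltree) : measurable [set w | A (uaf_tree x (V ^~ w) j)].
  by move=> _ Y _; rewrite setTI; exact: (mT _ [set t | Y (height t)%:R]).
elim: j A => [|j IH] A /=.
  have [At|nAt] := pselect (A root_tree).
    by rewrite (_ : [set _ | _] = setT)//; apply/seteqP; split.
  by rewrite (_ : [set _ | _] = set0)//; apply/seteqP; split.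
rewrite (_ : [set _ | _] = \bigcup_k (V j @^-1` [set k] `&`
    [set w | [set t | A (uaf_step x`_j k t)] (uaf_tree x (V ^~ w) j)])).
  apply: bigcupT_measurable => k; apply: measurableI; last exact: IH.
  by rewrite -[X in measurable X]setTI; exact: measurable_funP.
by apply/seteqP; split=> [w /= Aw|w [k _ [/= <-]]//]; exists (V j w).
Qed.

HB.instance Definition _ (R : realType) (d : measure_display)
    (Omega : measurableType d) (P : probability Omega R)
    (x : seq int) (V : nat -> {RV P >-> nat}) :=
  isMeasurableFun.Build _ _ _ _ (uaf_height x V) (measurable_uaf_height x V).

(* The two variables may live on different probability spaces. *)
Definition st_dominates (R : realType) (d d' : measure_display)
    (Omega : measurableType d) (Omega' : measurableType d')
    (P : probability Omega R) (P' : probability Omega' R)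
    (X : {RV P >-> R}) (Y : {RV P' >-> R}) : Prop :=
  forall t : R, (P' [set w | (t <= Y w)%R] <= P [set w | (t <= X w)%R])%E.

Arguments st_dominates {R d d' Omega Omega'} P P' X Y.

(** * The two choice sequences *)

Definition recursive_seq (n : nat) : seq int := nseq n 1.

Definition alternating_seq (n : nat) : seq int := flatten (nseq n [:: 1; -1]).

(* Main.v *)
Require Import Defs.
From mathcomp Require Import all_boot all_order all_algebra.
From mathcomp Require Import all_classical all_reals all_analysis.
From mathcomp Require Import zify.

(** The two laws already differ in the wrong direction at height 1. A tree with
    edges has height at most 1 exactly when it is a star centred at the root
    ([height_lt2P]).

    In the recursive tree every vertex stays active, so the star arises only if
    each of the [n] attachments picks the root; the [j]-th attachment picks
    among [j] vertices, which gives probability [1 / n!]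
    ([recursive_star_prob]). In the alternating tree there is a single active
    vertex before each attachment and there are two before each freezing. The
    star arises as soon as each of the first [n - 1] freezings spares the root,
    as the last freezing does not change the height. This has probability
    [1 / 2 ^ (n - 1)] ([alternating_star_prob]).

    For [n >= 3] one has [2 ^ (n - 1) < n!], so the alternating tree is a star
    with strictly larger probability than the recursive tree, and
    stochastic domination fails at the threshold 2. *)

Set Implicit Arguments.
Unset Strict Implicit.
Unset Printing Implicit Defensive.

Import Order.TTheory GRing.Theory Num.Theory.
Local Open Scope classical_set_scope.
Local Open Scope ring_scope.

(** * Trees of height at most one *)

Lemma walk_of_length0 (t : ltree) (u v : nat) :
  walk_of_length t u v 0 = (u == v).
Proof.
apply/existsP/idP => [[p]|uv]; first by rewrite tuple0.
by exists [tuple].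
Qed.

Lemma walk_of_length1 (t : ltree) (u v : nat) :
  (v < Defs.order t)%N -> walk_of_length t u v 1 = adj t u v.
Proof.
move=> vt; apply/existsP/idP => [[p]|uv].
  case/tupleP: p => a p; rewrite tuple0 /= andbT => /andP[ua /eqP <-//].
by exists [tuple Ordinal vt]; rewrite /= uv eqxx.
Qed.

(** With at least two vertices, the value [order t] that marks an unreachable
    vertex is at least 2, so height at most 1 forces every non-root vertex to be
    a neighbour of the root, even if the graph is disconnected. *)
Lemma height_lt2P (t : ltree) : (1 < Defs.order t)%N ->
  reflect (forall v, (0 < v < Defs.order t)%N -> adj t 0 v) (height t < 2)%N.
Proof.
move=> t1.
have dist v : (v < Defs.order t)%N ->
    (graph_dist t 0 v < 2)%N = (v == 0%N) || adj t 0 v.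
  move=> vt; rewrite -(walk_of_length1 _ vt) (eq_sym v).
  rewrite -(walk_of_length0 t 0 v) /graph_dist.
  case: (Defs.order t) t1 => [|[|m]]//= _.
  by case: (walk_of_length _ _ _ 0); case: (walk_of_length _ _ _ 1).
apply: (iffP idP) => [ht v /andP[v0 vt]|star].
  have: (graph_dist t 0 v < 2)%N.
    apply: leq_ltn_trans ht.
    exact: (leq_bigmax_cond (F := fun i : 'I__ => graph_dist t 0 i)
      (Ordinal vt)).
  by rewrite dist// eqn0Ngt v0.
rewrite ltnS; apply/bigmax_leqP => i _; rewrite -ltnS dist//.
by case: (posnP i) => //= i0; rewrite star ?orbT// i0 ltn_ord.
Qed.

(** * The trees of the two choice sequences *)

Lemma iota_rcons (m n : nat) : iota m n.+1 = rcons (iota m n) (m + n)%N.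
Proof. by rewrite -addn1 iotaD cats1. Qed.

Definition parent_edges (p : nat -> nat) (j : nat) : seq (nat * nat) :=
  rev [seq (p i, i.+1) | i <- iota 0 j].

Lemma parent_edgesS (p : nat -> nat) (j : nat) :
  parent_edges p j.+1 = (p j, j.+1) :: parent_edges p j.
Proof. by rewrite /parent_edges iota_rcons map_rcons rev_rcons. Qed.

(** Only edges pointing to positive vertices are listed, so a neighbour of the
    root is a vertex whose parent is the root. The parents are arbitrary
    numbers, because a choice may lie outside the current tree on a null set. *)
Lemma height_parent_edges (p : nat -> nat) (j : nat) (f : seq nat) :
  (0 < j)%N ->
  (height (LTree j.+1 (parent_edges p j) f) < 2)%N <->
  (forall i, (i < j)%N -> p i = 0%N).
Proof.
move=> j0; have mem (a b : nat) : ((a, b) \in parent_edges p j) =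
    [&& (0 < b)%N, (b <= j)%N & p b.-1 == a].
  rewrite /parent_edges mem_rev; apply/mapP/idP.
    move=> [i]; rewrite mem_iota /= add0n => ij [-> ->] /=.
    by rewrite ij eqxx.
  case: b => //= b /andP[bj /eqP <-]; exists b => //.
  by rewrite mem_iota.
split=> [/height_lt2P star i ij|root].
  have /star : (0 < i.+1 < j.+1)%N by [].
  by rewrite /adj /= !mem /= ij orbF => /(_ j0)/eqP.
apply/height_lt2P => //= -[//|v] /=; rewrite ltnS => vj.
by rewrite /adj /= !mem /= vj root// eqxx.
Qed.

Lemma recursive_tree (n : nat) (v : nat -> nat) (j : nat) : (j <= n)%N ->
  uaf_tree (recursive_seq n) v j = LTree j.+1 (parent_edges v j) [::].
Proof.
elim: j => [//|j IH] jn /=.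
by rewrite IH ?(ltnW jn)// nth_nseq jn /uaf_step eqxx /attach parent_edgesS.
Qed.

Lemma size_alternating (n : nat) : size (alternating_seq n) = n.*2.
Proof. by elim: n => //= n ->. Qed.

Lemma nth_alternating (n k : nat) : (k < n.*2)%N ->
  (alternating_seq n)`_k = if odd k then -1 else 1.
Proof. by elim: n k => [//|n IH] [|[|k]]//= kn; rewrite IH// negbK. Qed.

(** An attachment at an even time [i.*2] creates the vertex [i.+1]. *)
Lemma alternating_tree (n : nat) (v : nat -> nat) (i : nat) : (i <= n)%N ->
  uaf_tree (alternating_seq n) v i.*2 =
  LTree i.+1 (parent_edges (fun k => v k.*2) i)
    (rev [seq v k.*2.+1 | k <- iota 0 i]).
Proof.
elim: i => [//|i IH] lt_in.
rewrite iota_rcons map_rcons rev_rcons parent_edgesS doubleS /=.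
rewrite IH ?(ltnW lt_in)// !nth_alternating; try lia.
by rewrite /= odd_double /= /uaf_step eqxx.
Qed.

Lemma alternating_tree_odd (n : nat) (v : nat -> nat) (i : nat) : (i < n)%N ->
  uaf_tree (alternating_seq n) v i.*2.+1 =
  attach (v i.*2) (uaf_tree (alternating_seq n) v i.*2).
Proof.
by move=> lt_in; rewrite /= nth_alternating ?odd_double ?ltn_double.
Qed.

(** The choices that keep the root active forever: always attach to the root,
    and freeze each new leaf at once. *)
Definition root_choices (k : nat) : nat := if odd k then k./2.+1 else 0.

Lemma root_choices_even (i : nat) : root_choices i.*2 = 0%N.
Proof. by rewrite /root_choices odd_double. Qed.

Lemma root_choices_odd (i : nat) : root_choices i.*2.+1 = i.+1.
Proof. by rewrite /root_choices /= odd_double uphalf_double. Qed.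

Lemma active_alternating (n i : nat) : (i <= n)%N ->
  active (uaf_tree (alternating_seq n) root_choices i.*2) = [:: 0%N].
Proof.
move=> le_in; rewrite alternating_tree// /active /= mem_rev.
under eq_map => k do rewrite root_choices_odd.
have -> : [seq k.+1 | k <- iota 0 i] = iota 1 i by rewrite (iotaDl 1 0).
rewrite mem_iota /=; congr cons; apply/eqP; rewrite -[_ == _]negbK -has_filter.
by apply/hasPn => w; rewrite mem_rev negbK.
Qed.

Lemma active_alternating_odd (n i : nat) : (i < n)%N ->
  active (uaf_tree (alternating_seq n) root_choices i.*2.+1) = [:: 0%N; i.+1].
Proof.
move=> lt_in; rewrite alternating_tree_odd//.
have := active_alternating (ltnW lt_in).
rewrite alternating_tree 1?ltnW// /active /attach.
rewrite [Defs.order (LTree _ _ _)]/= [frozen (LTree _ _ _)]/=.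
rewrite (iota_rcons 0 i.+1) filter_rcons => ->.
rewrite /= mem_rev ifT//; apply/mapP => -[k].
by rewrite mem_iota root_choices_odd => ? [?]; lia.
Qed.

(** * Probabilities of the two stars *)

Section choices.
Variables (R : realType) (d : measure_display) (Omega : measurableType d).
Variables (P : probability Omega R) (V : nat -> {RV P >-> nat}).

Definition first_choices (v : nat -> nat) (j : nat) : set Omega :=
  [set w | forall i, (i < j)%N -> V i w = v i].

Lemma measurable_first_choices (v : nat -> nat) (j : nat) :
  measurable (first_choices v j).
Proof.
rewrite (_ : first_choices v j =
    \bigcap_(i in [set i | (i < j)%N]) (V i @^-1` [set v i])).
  apply: bigcap_measurableType => i _.
  by rewrite -[X in measurable X]setTI; exact: measurable_funP.
by apply/seteqP; split.
Qed.

Lemma first_choices0 (v : nat -> nat) : P (first_choices v 0) = 1%E.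
Proof.
rewrite (_ : first_choices v 0 = setT) ?probability_setT//.
by apply/seteqP; split.
Qed.

Lemma first_choicesS (x : seq int) (v : nat -> nat) (j : nat) (a : seq nat) :
  uaf_choices P x V -> (j < size x)%N ->
  active (uaf_tree x v j) = a -> v j \in a ->
  P (first_choices v j.+1) = (P (first_choices v j) * (size a)%:R^-1%:E)%E.
Proof. by move=> [_ hV] jx <- va; have := hV j v jx; rewrite /= va. Qed.

Lemma recursive_star_prob (n j : nat) : uaf_choices P (recursive_seq n) V ->
  (j <= n)%N -> P (first_choices (fun=> 0%N) j) = (j`!%:R^-1)%:E.
Proof.
move=> hV; elim: j => [|j IH] jn; first by rewrite first_choices0 invr1.
rewrite (first_choicesS (a := iota 0 j.+1) hV); last 3 first.
- by rewrite size_nseq.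
- rewrite recursive_tree ?(ltnW jn)// /active.
  by apply/all_filterP/allP.
- by rewrite mem_iota.
by rewrite IH ?(ltnW jn)// size_iota -EFinM factS natrM invfM mulrC.
Qed.

(** The exponent counts the freezings among the first [2 i + 1] choices; the
    attachments have a single active vertex to choose from. *)
Lemma alternating_star_prob (n i : nat) :
  uaf_choices P (alternating_seq n) V -> (i < n)%N ->
  P (first_choices root_choices i.*2.+1) = ((2 ^ i)%:R^-1)%:E.
Proof.
move=> hV; elim: i => [|i IH] lt_in.
  rewrite (first_choicesS (a := [:: 0%N]) hV)//.
    by rewrite first_choices0 mul1e.
  by rewrite size_alternating double_gt0.
rewrite doubleS (first_choicesS (a := [:: 0%N]) hV); last 3 first.
- by rewrite size_alternating -doubleS ltn_double.
- by rewrite -doubleS active_alternating// ltnW.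
- by rewrite -doubleS root_choices_even.
rewrite (first_choicesS (a := [:: 0%N; i.+1]) hV); last 3 first.
- by rewrite size_alternating; lia.
- by rewrite active_alternating_odd// ltnW.
- by rewrite root_choices_odd !inE eqxx orbT.
by rewrite IH 1?ltnW// -!EFinM invr1 mulr1 expnSr natrM invfM mulrC.
Qed.

Definition star_event (x : seq int) : set Omega :=
  [set w | (height (uaf_tree x (V ^~ w) (size x)) < 2)%N].

Lemma measurable_star_event (x : seq int) : measurable (star_event x).
Proof.
rewrite (_ : star_event x = uaf_height x V @^-1` [set y | (y < 2%:R)%R]).
  rewrite -[X in measurable X]setTI; apply: measurable_uaf_height => //.
  by rewrite -set_itvNyo; exact: measurable_itv.
by apply/seteqP; split => w; rewrite /star_event /= /uaf_height ltr_nat.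
Qed.

Lemma prob_uaf_height_ge2 (x : seq int) :
  P [set w | 2%:R <= uaf_height x V w] = (1 - P (star_event x))%E.
Proof.
rewrite -probability_setC; last exact: measurable_star_event.
congr (P _); apply/seteqP.
by split => w; rewrite /star_event /= /uaf_height ler_nat (leqNgt 2) => /negP.
Qed.

(** An equality of events, not only up to a null set: a choice outside the
    current tree never produces a graph of height below 2. *)
Lemma recursive_star (n : nat) : (0 < n)%N ->
  star_event (recursive_seq n) = first_choices (fun=> 0%N) n.
Proof.
move=> n0; rewrite /star_event; apply/seteqP; split => w /=;
  by rewrite size_nseq recursive_tree// height_parent_edges.
Qed.

(** The choices are prescribed up to the last attachment only, since freezing
    does not change the height. *)
Lemma alternating_star (n : nat) :
  first_choices root_choices n.*2.+1 `<=` star_event (alternating_seq n.+1).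
Proof.
move=> w hw; rewrite /star_event /mkset size_alternating alternating_tree//.
apply/height_parent_edges => // i; rewrite ltnS => le_in.
by rewrite hw ?root_choices_even// ltnS leq_double.
Qed.

End choices.

Lemma ltn_exp2_fact (n : nat) : (2 <= n)%N -> (2 ^ n < n.+1`!)%N.
Proof.
elim: n => [//|[|[|n]] IH]// _.
by rewrite expnS factS; apply: ltn_mul; rewrite ?IH.
Qed.

Theorem mainTheorem4 (R : realType) (n : nat) (hn : (3 <= n)%N)
  (dA : measure_display) (OmegaA : measurableType dA)
  (PA : probability OmegaA R) (VA : nat -> {RV PA >-> nat})
  (hA : uaf_choices PA (alternating_seq n) VA)
  (dR : measure_display) (OmegaR : measurableType dR)
  (PR : probability OmegaR R) (VR : nat -> {RV PR >-> nat})
  (hR : uaf_choices PR (recursive_seq n) VR) :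
  ~ st_dominates PA PR
      (uaf_height (alternating_seq n) VA)
      (uaf_height (recursive_seq n) VR).
Proof.
case: n hn hA hR => [//|n] hn hA hR /(_ 2%:R).
rewrite !prob_uaf_height_ge2 recursive_star// (recursive_star_prob hR)//.
set star := star_event _ _.
have mstar : measurable star by exact: measurable_star_event.
have : (((2 ^ n)%:R^-1)%:E <= PA star)%E.
  rewrite -(alternating_star_prob hA)//; apply: le_measure.
  - by rewrite inE; exact: measurable_first_choices.
  - by rewrite inE.
  - exact: alternating_star.
rewrite -(fineK (fin_num_measure PA _ mstar)) -!EFinB !lee_fin lerD2l lerN2.
move=> le_star /(le_trans le_star).
rewrite lef_pV2 ?posrE ?ltr0n ?expn_gt0 ?fact_gt0// ler_nat.
by rewrite leqNgt ltn_exp2_fact.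
Qed.
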